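(* Let $n\ge1$. For every $m\geq0$, $$\dim H_m(\mathbb H^n)=\binom{m+2n-1}{2n-1}.$$ In particular, $\dim H_m(\mathbb H^1)=m+1$.
   Context: $\mathbb H^n=\mathbb C^n\times\mathbb R$, $z_j=x_j+iy_j$, with horizontal fields $X_j=\partial_{x_j}+2y_j\partial_t$, $Y_j=\partial_{y_j}-2x_j\partial_t$ and sub-Laplacian $\Delta_H=\sum_{j=1}^n(X_j^2+Y_j^2)$. Dilations are $\delta_r(z,t)=(rz,r^2t)$. $P_m(\mathbb H^n)$ is the space of polynomials $p$ in $(x,y,t)$ with complex coefficients such that $p\circ\delta_r=r^mp$ for every $r>0$ ($\{0\}$ for $m<0$), and $H_m(\mathbb H^n)=\ker(\Delta_H|_{P_m(\mathbb H^n)})$. Dimensions are over $\mathbb C$. *)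

(* Defs.v *)
From mathcomp Require Import all_boot all_order all_algebra.
From mathcomp Require Import reals complex mpoly.

Set Implicit Arguments.
Unset Strict Implicit.
Unset Printing Implicit Defensive.

Import Order.TTheory GRing.Theory Num.Theory.
Local Open Scope ring_scope.
Local Open Scope complex_scope.

(* Polynomial spaces are not [vectType]s, so dimensions of subspaces of an
   arbitrary [lmodType] are expressed by the existence of a basis with d
   elements: [has_dim S d] says that S is the span of d linearly independent
   vectors. *)
Definition lin_indep (F : fieldType) (V : lmodType F) (d : nat)
    (b : 'I_d -> V) : Prop :=
  forall c : 'I_d -> F, \sum_(i < d) c i *: b i = 0 -> forall i, c i = 0.

Definition has_dim (F : fieldType) (V : lmodType F) (S : V -> Prop)
    (d : nat) : Prop :=
  exists b : 'I_d -> V, lin_indep b /\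
    forall v, S v <-> exists c : 'I_d -> F, v = \sum_(i < d) c i *: b i.

(* The coordinates (x_1, ..., x_n, y_1, ..., y_n, t) of H^n = C^n x R are
   indexed in this order by 'I_(n + n + 1). *)
Definition x_ (n : nat) (j : 'I_n) : 'I_(n + n + 1) := lshift 1 (lshift n j).
Definition y_ (n : nat) (j : 'I_n) : 'I_(n + n + 1) := lshift 1 (rshift n j).
Definition t_ (n : nat) : 'I_(n + n + 1) := rshift (n + n) ord0.

(* Since the field of real numbers is infinite, complex-valued polynomial
   functions of the real coordinates (x, y, t) are identified with formal
   polynomials over the complex numbers R[i]. *)
Section Heisenberg.
Variables (R : realType) (n : nat).
Implicit Types (p : {mpoly R[i][n + n + 1]}) (j : 'I_n) (r : R).

Definition Xf j p : {mpoly R[i][n + n + 1]} :=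
  p^`M(x_ j) + 2%:R *: ('X_(y_ j) * p^`M(t_ n)).

Definition Yf j p : {mpoly R[i][n + n + 1]} :=
  p^`M(y_ j) - 2%:R *: ('X_(x_ j) * p^`M(t_ n)).

Definition subLaplacian p : {mpoly R[i][n + n + 1]} :=
  \sum_(j < n) (Xf j (Xf j p) + Yf j (Yf j p)).

(* The components of delta_r, so that [p \mPo dilation r] is p o delta_r. *)
Definition dilation r : (n + n + 1).-tuple {mpoly R[i][n + n + 1]} :=
  [tuple (if k == t_ n then r ^+ 2 else r)%:C *: 'X_k | k < n + n + 1].

Definition P_ (m : nat) p : Prop :=
  forall r, 0 < r -> p \mPo dilation r = (r ^+ m)%:C *: p.

Definition H_ (m : nat) p : Prop := P_ m p /\ subLaplacian p = 0.

End Heisenberg.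

(* Main.v *)
Require Import Defs.
From HB Require Import structures.
From mathcomp Require Import all_boot all_order all_algebra.
From mathcomp Require Import reals complex mpoly.
From mathcomp Require Import zify.

(** The dimension is found by solving a Cauchy problem in the variable x_1.

    Write D for the derivative in x_1.  The coefficient of D^2 in the
    sub-Laplacian L is the constant 1, and every other term of L contains at
    most one derivative in x_1, so a solution of L p = 0 should be determined
    by its Cauchy data on x_1 = 0, that is, by its part of degree at most 1 in
    x_1.  To prove this, let J be the double antiderivative in x_1 and put
    N = J (D^2 - L) ([picard]).  Both D^2 and L lower the weighted degree
    by 2, and D^2 - L lowers the exponent of x_1 by at most 1, while J raises
    both quantities by 2.  Hence N preserves the weighted degree m and strictly
    raises the exponent of x_1 ([graded_picard]); since this exponent is at
    most m, N is nilpotent on P_m, and 1 - N ([cauchy]) is invertible there,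
    with the finite Neumann series as inverse.

    From (1 - N) p = (p - J D^2 p) + J L p one reads off that 1 - N maps H_m
    into the span U_m of the monomials of weighted degree m whose x_1-exponent
    is at most 1 ([H_cauchy]), because p - J D^2 p is the first-order Taylor
    part of p.  Differentiating twice gives D^2 (1 - N) p = L p
    ([deriv2_cauchy]), so the preimage of an element of U_m is harmonic
    ([solveP]).  Therefore H_m and U_m are isomorphic.

    It remains to count monomials ([dim_initial]).  As t has weight 2, an
    x_1-exponent a in {0, 1} and a t-exponent c together contribute a + 2 c to
    the weighted degree, and every natural number is uniquely of this form.
    So the monomials of U_m correspond to the 2 n-tuples of natural numbers
    of sum m, of which there are binomial(m + 2 n - 1, 2 n - 1). *)

Section HarmonicDimension.

Set Implicit Arguments.
Unset Strict Implicit.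
Unset Printing Implicit Defensive.
Import GRing.Theory Num.Theory.
Local Open Scope ring_scope.

(** * Transporting a dimension along a linear bijection *)

Section HasDim.
Variables (F : fieldType) (V : lmodType F).

(** The inverse [f] of [g] is a plain function: since [g] is linear and
    injective on [S], the images under [f] of a basis of [T] form a basis of
    [S].  As [S] is a bare predicate, its closure under linear combinations is
    a hypothesis. *)
Lemma has_dim_bij (S T : V -> Prop) (d : nat) (g : {linear V -> V}) :
  (forall (k : nat) (c : 'I_k -> F) (b : 'I_k -> V), (forall i, S (b i)) ->
     S (\sum_(i < k) c i *: b i)) ->
  (forall v, S v -> g v = 0 -> v = 0) ->
  (forall v, S v -> T (g v)) ->
  forall f : V -> V, (forall u, T u -> S (f u) /\ g (f u) = u) ->
  has_dim T d -> has_dim S d.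
Proof.
move=> Slin ginj gST f fP [u [uindep uspan]].
have Tu i : T (u i).
  apply/uspan; exists (fun j => (i == j)%:R).
  rewrite (bigD1 i) //= eqxx scale1r big1 ?addr0 // => j ji.
  by rewrite eq_sym (negbTE ji) scale0r.
have gfu c : g (\sum_(i < d) c i *: f (u i)) = \sum_(i < d) c i *: u i.
  by rewrite linear_sum; apply: eq_bigr => i _; rewrite linearZ (fP _ (Tu i)).2.
have Sfu c : S (\sum_(i < d) c i *: f (u i)).
  by apply: Slin => i; case: (fP _ (Tu i)).
exists (f \o u); split=> [c /= c0|v].
  by apply: uindep; rewrite -gfu c0 linear0.
split=> [Sv|[c ->]]; last exact: Sfu.
have /uspan[c gv] := gST v Sv; exists c.
apply/eqP; rewrite -subr_eq0; apply/eqP/ginj; last first.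
  by rewrite linearB /= gv gfu subrr.
(* The difference lies in S, being a combination of two members of S. *)
have := Slin 2%N (fun i => if i == ord0 then 1 else -1)
  (fun i => if i == ord0 then v else \sum_(i < d) c i *: f (u i)).
rewrite !big_ord_recl big_ord0 /= addr0 scale1r scaleN1r; apply => i.
by case: (i == ord0); [|exact: Sfu].
Qed.
End HasDim.

(** * Polynomials with prescribed support, and antiderivatives *)

Section Supports.
Variables (N : nat) (F : numFieldType).
Implicit Types (p q : {mpoly F[N]}) (mu nu : 'X_{1..N}).

Definition supp_in (Q : pred 'X_{1..N}) p := forall mu, p@_mu != 0 -> Q mu.

Lemma has_dim_monomials (Q : pred 'X_{1..N}) (d : nat)
    (e : 'I_d -> 'X_{1..N}) :
  injective e -> (forall k : 'I_d, Q (e k)) ->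
  (forall mu, Q mu -> exists k, e k = mu) ->
  has_dim (supp_in Q) d.
Proof.
move=> inje Qe eQ.
have coefe c (i : 'I_d) :
    (\sum_(j < d) c j *: 'X_[e j] : {mpoly F[N]})@_(e i) = c i.
  rewrite raddf_sum (bigD1 i) //= mcoeffZ mcoeffX eqxx mulr1.
  rewrite big1 ?addr0 // => j ji.
  by rewrite mcoeffZ mcoeffX (inj_eq inje) (negbTE ji) mulr0.
exists (fun i => 'X_[e i]); split=> [c c0 i|p].
  by rewrite -(coefe c) c0 mcoeff0.
split=> [Qp|[c ->] mu].
  exists (fun i => p@_(e i)); apply/mpolyP => mu.
  have [/eQ[i <-]|Qmu] := boolP (Q mu); first by rewrite coefe.
  have -> : p@_mu = 0 by apply/eqP; apply: contraNT Qmu; apply: Qp.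
  rewrite raddf_sum big1 //= => j _; rewrite mcoeffZ mcoeffX.
  by case: eqP => [ejmu|]; rewrite ?mulr0 //; rewrite -ejmu Qe in Qmu.
rewrite raddf_sum; apply: contraNT => Qmu; rewrite big1 //= => j _.
rewrite mcoeffZ mcoeffX.
by case: eqP => [ejmu|]; rewrite ?mulr0 //; rewrite -ejmu Qe in Qmu.
Qed.

Lemma supp_inW (Q Q' : pred 'X_{1..N}) p :
  (forall mu, Q mu -> Q' mu) -> supp_in Q p -> supp_in Q' p.
Proof. by move=> QQ' Qp mu /Qp/QQ'. Qed.

Lemma supp_in0 Q : supp_in Q 0.
Proof. by move=> mu; rewrite mcoeff0 eqxx. Qed.

Lemma supp_inD Q p q : supp_in Q p -> supp_in Q q -> supp_in Q (p + q).
Proof.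
move=> Qp Qq mu; rewrite mcoeffD; have [->|/Qp//] := eqVneq p@_mu 0.
by rewrite add0r => /Qq.
Qed.

Lemma supp_inZ Q c p : supp_in Q p -> supp_in Q (c *: p).
Proof. by move=> Qp mu; rewrite mcoeffZ mulf_eq0 negb_or => /andP[_ /Qp]. Qed.

Lemma supp_inN Q p : supp_in Q p -> supp_in Q (- p).
Proof. by move=> Qp mu; rewrite mcoeffN oppr_eq0 => /Qp. Qed.

Lemma supp_in_sum Q I (r : seq I) (P : pred I) (f : I -> {mpoly F[N]}) :
  (forall i, P i -> supp_in Q (f i)) -> supp_in Q (\sum_(i <- r | P i) f i).
Proof.
by move=> Qf; apply: big_ind => //; [exact: supp_in0|exact: supp_inD].
Qed.

Lemma supp_in_pred0 p : supp_in pred0 p -> p = 0.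
Proof.
by move=> p0; apply/mpolyP => mu; rewrite mcoeff0; apply/eqP/negPn/negP => /p0.
Qed.

Lemma supp_in_deriv (Q Q' : pred 'X_{1..N}) (i : 'I_N) p :
  (forall mu, Q (mu + U_(i))%MM -> Q' mu) -> supp_in Q p -> supp_in Q' p^`M(i).
Proof.
move=> QQ' Qp mu; rewrite mcoeff_deriv -mulr_natr mulf_eq0 negb_or.
by case/andP => /Qp/QQ'.
Qed.

Lemma supp_inMX (Q Q' : pred 'X_{1..N}) (i : 'I_N) p :
  (forall mu, Q mu -> Q' (mu + U_(i))%MM) ->
  supp_in Q p -> supp_in Q' ('X_i * p).
Proof.
move=> QQ' Qp mu; rewrite -mcoeff_msupp mulrC.
rewrite (perm_mem (msuppMX _ _)) => /mapP[nu]; rewrite mcoeff_msupp.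
by move=> /Qp/QQ' + ->; rewrite addmC.
Qed.

(** The antiderivative in the [i]-th variable that vanishes where this variable
    is 0. *)
Definition antideriv (i : 'I_N) p : {mpoly F[N]} :=
  \sum_(mu <- msupp p) (p@_mu / (mu i).+1%:R) *: 'X_[mu + U_(i)].

Lemma mcoeff_antiderivU (i : 'I_N) p mu :
  (antideriv i p)@_(mu + U_(i)) = p@_mu / (mu i).+1%:R.
Proof.
rewrite raddf_sum /=.
under eq_bigr do rewrite mcoeffZ mcoeffX (inj_eq (@addIm _ _)).
have [mup|mup] := boolP (mu \in msupp p).
  rewrite (bigD1_seq mu) //= eqxx mulr1 big1 ?addr0 // => nu /negbTE->.
  by rewrite mulr0.
rewrite (memN_msupp_eq0 mup) mul0r big_seq big1 // => nu nup.
by case: eqP => [nm|]; rewrite ?mulr0 //; rewrite -nm nup in mup.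
Qed.

Lemma mcoeff_antideriv0 (i : 'I_N) p mu : mu i = 0%N -> (antideriv i p)@_mu = 0.
Proof.
move=> mui; rewrite raddf_sum big1 //= => nu _; rewrite mcoeffZ mcoeffX.
case: eqP => [nm|]; rewrite ?mulr0 //.
by move: mui; rewrite -nm mnmDE mnm1E eqxx addn1.
Qed.

Lemma mnm_subU mu (i : 'I_N) : mu i != 0%N -> mu = (mu - U_(i) + U_(i))%MM.
Proof.
move=> mui; rewrite submK //; apply/mnm_lepP => j; rewrite mnm1E.
by case: eqP => // <-; rewrite lt0n.
Qed.

Lemma antideriv_is_linear (i : 'I_N) : linear (antideriv i).
Proof.
move=> c p q; apply/mpolyP => mu; rewrite mcoeffD mcoeffZ.
have [mu0|/mnm_subU->] := eqVneq (mu i) 0%N.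
  by rewrite !mcoeff_antideriv0 // mulr0 addr0.
by rewrite !mcoeff_antiderivU mcoeffD mcoeffZ mulrDl mulrA.
Qed.

Lemma antiderivK (i : 'I_N) p : (antideriv i p)^`M(i) = p.
Proof.
apply/mpolyP => mu; rewrite mcoeff_deriv mcoeff_antiderivU -[LHS]mulr_natr.
by rewrite divfK // pnatr_eq0.
Qed.

Lemma mcoeff_antideriv_deriv (i : 'I_N) p mu :
  mu i != 0%N -> (antideriv i p^`M(i))@_mu = p@_mu.
Proof.
move/mnm_subU->; rewrite mcoeff_antiderivU mcoeff_deriv.
by rewrite -[_ *+ _ in LHS]mulr_natr mulfK // pnatr_eq0.
Qed.

Lemma supp_in_antideriv (Q Q' : pred 'X_{1..N}) (i : 'I_N) p :
  (forall mu, Q mu -> Q' (mu + U_(i))%MM) ->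
  supp_in Q p -> supp_in Q' (antideriv i p).
Proof.
move=> QQ' Qp mu; have [/mcoeff_antideriv0->|/mnm_subU->] := eqVneq (mu i) 0%N.
  by rewrite eqxx.
by rewrite mcoeff_antiderivU mulf_eq0 negb_or => /andP[/Qp/QQ'].
Qed.

(** What two integrations cannot recover from the second derivative is the
    first-order Taylor polynomial of [p] in the [i]-th variable. *)
Lemma supp_in_taylor2 (i : 'I_N) p :
  supp_in (fun mu => (mu i <= 1)%N)
    (p - antideriv i (antideriv i p^`M(i)^`M(i))).
Proof.
move=> mu; apply: contraNT; rewrite -ltnNge => mui.
have mui0 : mu i != 0%N by rewrite -lt0n ltnW.
rewrite mcoeffB subr_eq0 -(mcoeff_antideriv_deriv p mui0) {1 2}(mnm_subU mui0).
rewrite !mcoeff_antiderivU mcoeff_antideriv_deriv //.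
by rewrite mnmBE mnm1E eqxx subn_eq0 -ltnNge.
Qed.

Lemma deriv2_eq0 (i : 'I_N) p :
  supp_in (fun mu => (mu i <= 1)%N) p -> p^`M(i)^`M(i) = 0.
Proof.
move=> p1; apply: supp_in_pred0.
apply: (supp_in_deriv (Q := fun mu => (mu i <= 0)%N)).
  by move=> mu; rewrite mnmDE mnm1E eqxx addn1.
by apply: (supp_in_deriv _ p1) => mu; rewrite mnmDE mnm1E eqxx addn1.
Qed.

End Supports.

Local Open Scope complex_scope.

(** * Dilations and weighted degree *)

Section Dilations.
Variables (R : realType) (n : nat).
Implicit Types (p : {mpoly R[i][n + n + 1]}) (mu : 'X_{1..n + n + 1}).

Definition hweight (i : 'I_(n + n + 1)) : nat := if i == t_ n then 2 else 1.

Definition wdeg mu : nat := \sum_i hweight i * mu i.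

Lemma wdegDU mu i : wdeg (mu + U_(i))%MM = (wdeg mu + hweight i)%N.
Proof.
rewrite /wdeg; under eq_bigr do rewrite mnmDE mulnDr.
rewrite big_split /=; congr (_ + _)%N.
rewrite (bigD1 i) //= mnm1E eqxx muln1 big1 ?addn0 // => j ji.
by rewrite mnm1E eq_sym (negbTE ji) muln0.
Qed.

Lemma mcoeff_dilation r p mu :
  (p \mPo dilation n r)@_mu = (r ^+ wdeg mu)%:C * p@_mu.
Proof.
have dilX (nu : 'X_{1..n + n + 1}) : \prod_i tnth (dilation n r) i ^+ nu i
    = (r ^+ wdeg nu)%:C *: 'X_[nu] :> {mpoly R[i][n + n + 1]}.
  under eq_bigr do rewrite tnth_mktuple exprZn.
  rewrite scaler_prod -mpolyXE_id; congr (_ *: _).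
  rewrite -prodrXr rmorph_prod; apply: eq_bigr => i _.
  by rewrite /hweight exprM -rmorphXn; case: (i == t_ n).
rewrite comp_mpolyE raddf_sum /= {3}[p]mpolyE raddf_sum mulr_sumr /=.
apply: eq_bigr => nu _; rewrite dilX !mcoeffZ mcoeffX.
by case: eqP => [->|]; rewrite ?mulr0 // !mulr1 mulrC.
Qed.

(** A dilation multiplies a monomial of weighted degree d by r ^ d.  Homogeneity
    under the single dilation r = 2 already forces d = m, since the powers of 2
    are distinct. *)
Lemma P_supp_in m p : P_ m p <-> supp_in (fun mu => wdeg mu == m) p.
Proof.
split=> [Pp mu pmu|Qp r r0].
  have /(congr1 (mcoeff mu)) := Pp 2%:R (ltr0Sn _ _).
  rewrite mcoeff_dilation mcoeffZ => /(mulIf pmu)/complexI/ieexprIn->//.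
  by rewrite pnatr_eq1.
apply/mpolyP => mu; rewrite mcoeff_dilation mcoeffZ.
by have [->|/Qp/eqP->] := eqVneq p@_mu 0; rewrite ?mulr0.
Qed.
End Dilations.

(** * Linearity of the sub-Laplacian *)

Section LinearFields.
Variables (R : realType) (n : nat).

Lemma Xf_is_linear j : linear (@Xf R n j).
Proof.
move=> c p q; rewrite /Xf !linearP /= mulrDr -scalerAr.
by rewrite !scalerDr !scalerA [c * _]mulrC addrACA.
Qed.

Lemma Yf_is_linear j : linear (@Yf R n j).
Proof.
move=> c p q; rewrite /Yf !linearP /= mulrDr -scalerAr.
by rewrite scalerDr scalerBr !scalerA [c * _]mulrC opprD addrACA.
Qed.

Lemma subLaplacian_is_linear : linear (@subLaplacian R n).
Proof.
move=> c p q; rewrite /subLaplacian scaler_sumr -big_split /=.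
by apply: eq_bigr => j _; rewrite !Xf_is_linear !Yf_is_linear addrACA -scalerDr.
Qed.

HB.instance Definition _ := GRing.isLinear.Build R[i] {mpoly R[i][n + n + 1]}
  {mpoly R[i][n + n + 1]} _ (@subLaplacian R n) subLaplacian_is_linear.
End LinearFields.

(** * The Cauchy problem in the variable x_1 *)

Section Cauchy.
(* n = n'.+1 is positive, so that the variable x_1, of index ord0, exists. *)
Variables (R : realType) (n' m : nat).
Let n := n'.+1.
Let V := {mpoly R[i][n + n + 1]}.
Let x1 : 'I_(n + n + 1) := x_ ord0.
Implicit Types (p q u : V) (mu : 'X_{1..n + n + 1}).

(** Monomials of weighted degree m - s with x_1-exponent at least k.  The shift
    [s] is added to the degree rather than subtracted from [m], so that
    operators lowering the degree need no case distinction for small [m]. *)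
Definition graded s k : pred 'X_{1..n + n + 1} :=
  fun mu => (wdeg mu + s == m)%N && (k <= mu x1)%N.

(** The truncation in [k - (i == x1)] is harmless: a lower bound 0 on the
    x_1-exponent holds trivially. *)
Lemma gradedU s k mu i :
  graded s k (mu + U_(i))%MM = graded (s + hweight i) (k - (i == x1)) mu.
Proof.
rewrite /graded wdegDU mnmDE mnm1E leq_subLR [(nat_of_bool _ + _)%N]addnC.
by rewrite -[(_ + _ + s)%N]addnA [(_ + s)%N]addnC.
Qed.

Lemma graded_deriv s k i p :
  supp_in (graded s k) p ->
  supp_in (graded (s + hweight i) (k - (i == x1))) p^`M(i).
Proof. by apply: supp_in_deriv => mu; rewrite gradedU. Qed.

Lemma graded_MX s k i p :
  supp_in (graded (s + hweight i) k) p -> supp_in (graded s k) ('X_i * p).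
Proof.
apply: supp_inMX => mu; rewrite gradedU => /andP[mus /(leq_trans _) kmu].
by rewrite /graded mus kmu ?leq_subr.
Qed.

Lemma graded_antideriv s k i p :
  supp_in (graded (s + hweight i) k) p ->
  supp_in (graded s (k + (i == x1))) (antideriv i p).
Proof. by apply: supp_in_antideriv => mu; rewrite gradedU addnK. Qed.

Lemma graded_le s k l p :
  (l <= k)%N -> supp_in (graded s k) p -> supp_in (graded s l) p.
Proof.
move=> lk; apply: supp_inW => mu; rewrite /graded.
by case/andP=> [-> /(leq_trans lk)->].
Qed.

Lemma hweight_x j : hweight (@x_ n j) = 1%N.
Proof. by rewrite /hweight eq_lrshift. Qed.

Lemma hweight_y j : hweight (@y_ n j) = 1%N.
Proof. by rewrite /hweight eq_lrshift. Qed.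

Lemma hweight_t : hweight (t_ n) = 2%N.
Proof. by rewrite /hweight eqxx. Qed.

Lemma t_eq_x1 : (t_ n == x1) = false.
Proof. by rewrite eq_rlshift. Qed.

Lemma y_eq_x1 j : (y_ j == x1) = false.
Proof. by rewrite /y_ /x1 /x_ eq_lshift eq_rlshift. Qed.

Lemma x_eq_x1 j : (x_ j == x1) = (j == ord0).
Proof. by rewrite /x1 /x_ !eq_lshift. Qed.

Lemma graded_XDt s k i p : hweight i = 1%N ->
  supp_in (graded s k) p -> supp_in (graded s.+1 k) ('X_i * p^`M(t_ n)).
Proof.
move=> wi /(graded_deriv (i := t_ n)); rewrite hweight_t t_eq_x1 subn0.
rewrite [(s + 2)%N]addn2 => pt.
by apply: graded_MX; rewrite wi [(_.+1 + 1)%N]addn1.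
Qed.

Lemma graded_Xf s k j p : supp_in (graded s k) p ->
  supp_in (graded s.+1 (k - (j == ord0))) (Xf j p).
Proof.
move=> sp; apply: supp_inD.
  have := graded_deriv (i := x_ j) sp.
  by rewrite hweight_x x_eq_x1 [(s + 1)%N]addn1.
apply: supp_inZ; apply: graded_le (graded_XDt (hweight_y j) sp).
exact: leq_subr.
Qed.

Lemma graded_Yf s k j p : supp_in (graded s k) p ->
  supp_in (graded s.+1 k) (Yf j p).
Proof.
move=> sp; apply: supp_inD.
  have := graded_deriv (i := y_ j) sp.
  by rewrite hweight_y y_eq_x1 [(s + 1)%N]addn1 subn0.
by apply: supp_inN; apply: supp_inZ; apply: graded_XDt sp; rewrite hweight_x.
Qed.

(** D^2 - L loses at most one factor x_1.  The square X_1^2 is the only term of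
    L with two derivatives in x_1: writing X_1 = D + A with A = 2 y_1 d/dt, one
    has D^2 - X_1^2 = - D A - A X_1, and each summand differentiates at most
    once in x_1.  The field Y_1 contains x_1 as a factor but not d/dx_1, and the
    fields X_j, Y_j with j > 1 do not involve x_1. *)
Lemma graded_defect s k p : supp_in (graded s k) p ->
  supp_in (graded s.+2 k.-1) (p^`M(x1)^`M(x1) - subLaplacian p).
Proof.
move=> sp; rewrite /subLaplacian big_ord_recl opprD addrA opprD addrA.
have Y2 j : supp_in (graded s.+2 k.-1) (Yf j (Yf j p)).
  by apply: graded_le (leq_pred k) _; do 2![apply: graded_Yf].
apply: supp_inD; last first.
  apply: supp_inN; apply: supp_in_sum => j _; apply: supp_inD (Y2 _).
  apply: graded_le (leq_pred k) _.
  have Xj := graded_Xf (j := lift ord0 j).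
  by have := Xj _ _ _ (Xj _ _ _ sp); rewrite !subn0.
apply: supp_inD (supp_inN (Y2 _)).
pose A q : V := 2%:R *: ('X_(y_ ord0) * q^`M(t_ n)).
have XfE q : Xf ord0 q = q^`M(x1) + A q by [].
have -> : p^`M(x1)^`M(x1) - Xf ord0 (Xf ord0 p)
    = - (A p)^`M(x1) - A (Xf ord0 p).
  by rewrite XfE {1}XfE mderivD !opprD !addrA subrr sub0r.
apply: supp_inD; apply: supp_inN.
  have sA : supp_in (graded s.+1 k) (A p).
    by apply: supp_inZ; apply: graded_XDt (hweight_y _) sp.
  have := graded_deriv (i := x1) sA.
  by rewrite hweight_x eqxx subn1 [(s.+1 + 1)%N]addn1.
apply: supp_inZ; apply: graded_XDt (hweight_y _) _.
by have := graded_Xf (j := ord0) sp; rewrite subn1.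
Qed.

(** For u of degree at most 1 in x_1, the equation p = [picard] p + u is the
    Cauchy problem L p = 0 with data u on x_1 = 0: read L p = 0 as
    D^2 p = (D^2 - L) p and integrate twice. *)
Definition picard p : V :=
  antideriv x1 (antideriv x1 (p^`M(x1)^`M(x1) - subLaplacian p)).

Lemma graded_picard k p :
  supp_in (graded 0 k) p -> supp_in (graded 0 k.+1) (picard p).
Proof.
move=> /graded_defect sp.
have := @graded_antideriv 1 k.-1 x1 _; rewrite hweight_x => /(_ _ sp) sp1.
have := @graded_antideriv 0 _ x1 _; rewrite hweight_x => /(_ _ _ sp1).
by apply: graded_le; rewrite eqxx; case: k {sp sp1} => //= k; rewrite !addn1.
Qed.

Definition cauchy p : V := p - picard p.

Lemma cauchy_is_linear : linear cauchy.
Proof.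
move=> c p q; rewrite /cauchy /picard subLaplacian_is_linear !mderiv_is_linear.
rewrite opprD addrACA -scalerBr !antideriv_is_linear.
by rewrite opprD addrACA -scalerBr.
Qed.

HB.instance Definition _ :=
  GRing.isLinear.Build R[i] V V _ cauchy cauchy_is_linear.

Lemma deriv2_cauchy p : (cauchy p)^`M(x1)^`M(x1) = subLaplacian p.
Proof.
rewrite /cauchy /picard !mderivB !antiderivK.
by rewrite opprB addrC subrK.
Qed.

(** The x_1-exponent of a monomial is at most its weighted degree. *)
Lemma graded_eq0 p : supp_in (graded 0 m.+1) p -> p = 0.
Proof.
move=> sp; apply: supp_in_pred0; apply: supp_inW sp => mu /andP[/eqP].
rewrite addn0 /wdeg (bigD1 x1) //= hweight_x mul1n => <-.
by rewrite ltnNge leq_addr.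
Qed.

(** A fixed point of [picard] lies in the image of all its iterates, hence is
    divisible by arbitrarily high powers of x_1. *)
Lemma H_cauchy0 p : H_ m p -> cauchy p = 0 -> p = 0.
Proof.
case=> /P_supp_in mp _ /eqP; rewrite subr_eq0 => /eqP pN.
have sp k : supp_in (graded 0 k) p.
  elim: k => [|k /graded_picard]; last by rewrite -pN.
  by apply: supp_inW mp => mu; rewrite /graded addn0 andbT.
exact: graded_eq0 (sp m.+1).
Qed.

(** The monomials that may occur in the Cauchy data on x_1 = 0 of an element of
    P_m. *)
Definition initial : pred 'X_{1..n + n + 1} :=
  fun mu => (wdeg mu == m) && (mu x1 <= 1)%N.

Lemma H_cauchy p : H_ m p -> supp_in initial (cauchy p).
Proof.
case=> /P_supp_in mp Lp mu cmu; apply/andP; split; last first.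
  by move: cmu; rewrite /cauchy /picard Lp subr0 => /supp_in_taylor2.
have sp : supp_in (graded 0 0) p.
  by apply: supp_inW mp => nu; rewrite /graded addn0 andbT.
have sc : supp_in (graded 0 0) (cauchy p).
  by apply: supp_inD sp (supp_inN (graded_le (leq0n _) (graded_picard sp))).
by have /andP[] := sc mu cmu; rewrite addn0.
Qed.

(** The Neumann series of the inverse of 1 - [picard]. *)
Definition solve u : V := \sum_(0 <= k < m.+1) iter k picard u.

Lemma solveP u : supp_in initial u -> H_ m (solve u) /\ cauchy (solve u) = u.
Proof.
move=> su.
have sk k : supp_in (graded 0 k) (iter k picard u).
  elim: k => [|k]; last exact: graded_picard.
  by apply: supp_inW su => mu /andP[mu1 _]; rewrite /graded addn0 mu1.
have cu : cauchy (solve u) = u.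
  apply: oppr_inj; rewrite linear_sum -sumrN /=.
  under eq_bigr do rewrite opprB -iterS.
  by rewrite telescope_sumr // (graded_eq0 (sk m.+1)) sub0r.
split=> //; split; last first.
  rewrite -deriv2_cauchy cu; apply: deriv2_eq0.
  by apply: supp_inW su => mu /andP[].
apply/P_supp_in/supp_in_sum => k _; apply: supp_inW (sk k) => mu /andP[].
by rewrite addn0.
Qed.

(** * Counting the Cauchy data *)

(** The first entry e of the tuple encodes the exponents of x_1 and t as
    e = odd e + 2 * (e ./2); the other entries are the exponents of the
    remaining variables.  The length is n + n, written as a successor so that
    the tuple has a first entry. *)
Definition tuple_mon (s : (n' + n).+1.-tuple nat) : 'X_{1..n + n + 1} :=
  [multinom match split i with
            | inl j => if j == ord0 :> 'I_(n + n)
                       then odd (tnth s j) : nat else tnth s j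
            | inr _ => (tnth s ord0)./2
            end | i < n + n + 1].

Lemma tuple_mon_z s (j : 'I_(n + n)) : tuple_mon s (lshift 1 j) =
  if j == ord0 :> 'I_(n + n) then odd (tnth s j) : nat else tnth s j.
Proof.
rewrite mnmE; case: split_ordP => k /eqP; rewrite ?eq_lshift ?eq_lrshift //.
by move/eqP->.
Qed.

Lemma tuple_mon_t s : tuple_mon s (t_ n) = (tnth s ord0)./2.
Proof. by rewrite mnmE; case: split_ordP => // k /eqP; rewrite eq_rlshift. Qed.

Lemma wdeg_split mu : wdeg mu =
  (\sum_(j < n + n) mu (lshift 1 j) + (mu (t_ n)).*2)%N.
Proof.
rewrite /wdeg big_split_ord big_ord1 -/(t_ n) hweight_t mul2n; congr (_ + _)%N.
by apply: eq_bigr => j _; rewrite /hweight eq_lrshift mul1n.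
Qed.

Lemma wdeg_tuple_mon s : wdeg (tuple_mon s) = (\sum_(e <- s) e)%N.
Proof.
rewrite wdeg_split tuple_mon_t big_tuple !big_ord_recl.
rewrite (tuple_mon_z s ord0) eqxx.
under eq_bigr do rewrite tuple_mon_z.
by rewrite addnAC odd_double_half.
Qed.

Lemma x1E : x1 = lshift 1 (ord0 : 'I_(n + n)).
Proof. exact: val_inj. Qed.

Lemma tuple_mon_x1 s : (tuple_mon s x1 <= 1)%N.
Proof. by rewrite x1E tuple_mon_z eqxx; case: odd. Qed.

Lemma tuple_mon_inj : injective tuple_mon.
Proof.
move=> s s' e; apply: eq_from_tnth => j.
have [->|j0] := eqVneq j ord0.
  have := congr1 (fun mu => mu (t_ n)) e; rewrite !tuple_mon_t => et.
  have := congr1 (fun mu => mu (lshift 1 (ord0 : 'I_(n + n)))) e.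
  rewrite !tuple_mon_z eqxx => ex.
  by rewrite -[LHS]odd_double_half -[RHS]odd_double_half ex et.
have := congr1 (fun mu => mu (lshift 1 (j : 'I_(n + n)))) e.
by rewrite !tuple_mon_z (negbTE j0).
Qed.

Definition mon_tuple mu : (n' + n).+1.-tuple nat :=
  [tuple mu (lshift 1 (j : 'I_(n + n))) + (j == ord0) * (mu (t_ n)).*2
     | j < (n' + n).+1]%N.

Lemma mon_tupleK mu : (mu x1 <= 1)%N -> tuple_mon (mon_tuple mu) = mu.
Proof.
rewrite x1E => mu1; apply/mnmP => i; case: (split_ordP i) => j ->.
  rewrite tuple_mon_z tnth_mktuple; case: eqP => [->|_]; last by rewrite addn0.
  by rewrite mul1n oddD odd_double addbF; case: (mu _) mu1 => [|[|]].
rewrite ord1 -/(t_ n) tuple_mon_t tnth_mktuple mul1n.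
rewrite halfD odd_double andbF add0n doubleK.
by case: (mu _) mu1 => [|[|]].
Qed.

(** The tuples of sum m have entries at most m, and are counted as tuples over
    'I_m.+1. *)
Lemma dim_initial :
  has_dim (supp_in (F := R[i]) initial) 'C(n' + n + m, n' + n).
Proof.
rewrite -card_ord_partitions; set T := [set _ | _].
pose e (k : 'I_#|T|) := tuple_mon (map_tuple val (enum_val k)).
apply: (@has_dim_monomials _ _ initial _ e)
  => [k l /tuple_mon_inj ekl|k|mu /andP[/eqP mum mu1]].
- apply: enum_val_inj; apply: val_inj; apply: (inj_map val_inj).
  exact: (congr1 val ekl).
- rewrite /initial tuple_mon_x1 andbT wdeg_tuple_mon big_map.
  by have := enum_valP k; rewrite inE.
have sm : (\sum_(a <- mon_tuple mu) a = m)%N.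
  by rewrite -wdeg_tuple_mon mon_tupleK.
pose t := map_tuple (fun a => inord a : 'I_m.+1) (mon_tuple mu).
have tE : map_tuple val t = mon_tuple mu.
  apply: eq_from_tnth => j; rewrite 2!tnth_map [LHS]inordK //.
  by rewrite ltnS -sm big_tuple (bigD1 j) //= leq_addr.
have Tt : t \in T by move: sm; rewrite -tE big_map inE => ->.
exists (enum_rank_in Tt t).
by rewrite /e enum_rankK_in // tE mon_tupleK.
Qed.

Lemma dim_H : has_dim (@H_ R n m) 'C(n' + n + m, n' + n).
Proof.
apply: (@has_dim_bij _ V _ (supp_in initial) _ cauchy
  _ H_cauchy0 H_cauchy solve solveP).
  move=> k c b Hb; split.
    apply/P_supp_in/supp_in_sum => i _; apply: supp_inZ; apply/P_supp_in.
    by case: (Hb i).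
  rewrite linear_sum big1 // => i _.
  by rewrite [LHS]linearZ /= (Hb i).2 scaler0.
exact: dim_initial.
Qed.

End Cauchy.

End HarmonicDimension.

Theorem theorem5p2 (R : realType) :
  (forall n : nat, 1 <= n -> forall m : nat,
     has_dim (@H_ R n m) 'C(m + 2 * n - 1, 2 * n - 1)) /\
  (forall m : nat, has_dim (@H_ R 1 m) (m + 1)).
Proof.
have dimH n m : 1 <= n -> has_dim (@H_ R n m) 'C(m + 2 * n - 1, 2 * n - 1).
  case: n => // n _.
  have -> : m + 2 * n.+1 - 1 = n + n.+1 + m by lia.
  have -> : 2 * n.+1 - 1 = n + n.+1 by lia.
  exact: dim_H.
split=> [n n1 m|m]; first exact: dimH.
have -> : m + 1 = 'C(m + 2 * 1 - 1, 2 * 1 - 1) by rewrite muln1 bin1; lia.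
exact: dimH.
Qed.
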